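(* Assume (A1) and (A2) below. Then for any $(s,a)\in\mathcal S\times\mathcal A$ and policy $\pi$, $u_t(s,a)=w_t(s,a)-g_t(s,a)$, where $$u_t(s,a)=\mathbb{V}_{a',s'\sim\pi,\bar p_t}\big[\bar Q^\pi_t(s',a')\big]-\mathbb{E}_{p\sim\Phi_t}\Big[\mathbb{V}_{a',s'\sim\pi,p}\big[Q^{\pi,p}(s',a')\big]\Big],$$ $$w_t(s,a)=\mathbb{V}_{p\sim\Phi_t}\Big[\sum_{a',s'}\pi(a'\mid s')p(s'\mid s,a)\bar Q^\pi_t(s',a')\Big],$$ $$g_t(s,a)=\mathbb{E}_{p\sim\Phi_t}\Big[\mathbb{V}_{a',s'\sim\pi,p}\big[Q^{\pi,p}(s',a')\big]-\mathbb{V}_{a',s'\sim\pi,p}\big[\bar Q^\pi_t(s',a')\big]\Big].$$ Furthermore, $g_t(s,a)\ge0$, and hence $u_t(s,a)\le w_t(s,a)$.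
   Context: Let $\mathcal S$ be a finite state space, $\mathcal A$ a finite action space, $r:\mathcal S\times\mathcal A\to\mathbb R$ a known bounded (deterministic) reward function and $\gamma\in[0,1)$ a discount factor. A transition function $p$ assigns to each $(s,a)$ a probability distribution $p(\cdot\mid s,a)$ on $\mathcal S$. A policy $\pi$ gives distributions $\pi(\cdot\mid s)$ on $\mathcal A$. For a transition function $p$, $Q^{\pi,p}(s,a)=\mathbb E\big[\sum_{h\ge 0}\gamma^h r(s_h,a_h)\mid s_0=s,a_0=a\big]$ with $s_{h+1}\sim p(\cdot\mid s_h,a_h)$ and $a_{h}\sim\pi(\cdot\mid s_{h})$ for $h\ge1$. The transition function $p$ is a random variable with distribution $\Phi_t$. Define $\bar p_t(s'\mid s,a)=\mathbb E_{p\sim\Phi_t}[p(s'\mid s,a)]$ and $\bar Q^\pi_t(s,a)=\mathbb E_{p\sim\Phi_t}[Q^{\pi,p}(s,a)]$. For a transition function $q$ and a function $f$ on $\mathcal S\times\mathcal A$, $\mathbb V_{a',s'\sim\pi,q}[f(s',a')]$ denotes the variance of $f(s',a')$ when $s'\sim q(\cdot\mid s,a)$ and $a'\sim\pi(\cdot\mid s')$. Assumptions: (A1) (independent transitions) $p(s'\mid x,a)$ and $p(s'\mid y,a)$ are independent random variables if $x\neq y$; (A2) (acyclic MDP) the MDP is a directed acyclic graph, i.e., states are not visited more than once in any given episode.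
   Formalization: (A1) is taken as mutual independence of the full transition rows of distinct states, since with the literal pairwise condition g_t ≥ 0 can fail; (A2) is taken as no cycles except staying in absorbing terminal states, since literally no state being revisited is impossible. *)

(* Defs.v *)
From HB Require Import structures.
From mathcomp Require Import all_boot all_order all_algebra.
From mathcomp Require Import all_classical all_reals all_analysis.
From Stdlib Require Import Relations.
Set Implicit Arguments. Unset Strict Implicit. Unset Printing Implicit Defensive.
Import Order.TTheory GRing.Theory Num.Theory.
Local Open Scope classical_set_scope.
Local Open Scope ring_scope.

Section MDP.
Variables (R : realType) (S A : finType).

(* Conventions:
   - a transition function is  q : S -> A -> S -> R  with  q s a s' = q(s'|s,a);
   - a policy is  pi : S -> A -> R  with  pi s a = pi(a|s);
   - a reward is  r : S -> A -> R. *)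

Definition is_distr_on (T : finType) (f : T -> R) :=
  (forall t, 0 <= f t) /\ \sum_(t : T) f t = 1.

Definition is_transition (q : S -> A -> S -> R) :=
  forall s a, is_distr_on (q s a).

Definition is_policy (pi : S -> A -> R) := forall s, is_distr_on (pi s).

(* ER pi q r h s a = E[ r(s_h, a_h) | s_0 = s, a_0 = a ] under q and pi. *)
Fixpoint ER (pi : S -> A -> R) (q : S -> A -> S -> R) (r : S -> A -> R)
    (h : nat) (s : S) (a : A) : R :=
  match h with
  | 0 => r s a
  | h'.+1 => \sum_(s' : S) q s a s' *
               \sum_(a' : A) pi s' a' * ER pi q r h' s' a'
  end.

Definition Qpi (gamma : R) (pi : S -> A -> R) (q : S -> A -> S -> R)
    (r : S -> A -> R) (s : S) (a : A) : R :=
  limn (fun n => \sum_(0 <= h < n) gamma ^+ h * ER pi q r h s a).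

Definition mean_next (pi : S -> A -> R) (q : S -> A -> S -> R) (s : S) (a : A)
    (f : S -> A -> R) : R :=
  \sum_(s' : S) \sum_(a' : A) pi s' a' * q s a s' * f s' a'.

Definition var_next (pi : S -> A -> R) (q : S -> A -> S -> R) (s : S) (a : A)
    (f : S -> A -> R) : R :=
  \sum_(s' : S) \sum_(a' : A)
     pi s' a' * q s a s' * (f s' a' - mean_next pi q s a f) ^+ 2.

Variables (d : measure_display) (Omega : measurableType d)
          (P : probability Omega R).

Definition Ex (X : Omega -> R) : R := fine (\int[P]_w (X w)%:E).

Definition Var (X : Omega -> R) : R := Ex (fun w => (X w - Ex X) ^+ 2).

Variable p : Omega -> S -> A -> S -> R.

Definition pbar : S -> A -> S -> R := fun x b y => Ex (fun w => p w x b y).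

Definition Qbar (gamma : R) (pi : S -> A -> R) (r : S -> A -> R) : S -> A -> R :=
  fun s a => Ex (fun w => Qpi gamma pi (p w) r s a).

Definition gen_state (x : S) : set (set Omega) :=
  [set E | exists (b : A) (y : S) (B : set R),
             measurable B /\ E = (fun w => p w x b y) @^-1` B].

(* (A1), read as mutual independence of the random vectors
   (p(.|x,.))_{x in S}: product rule for every finite subfamily of events. *)
Definition indep_transitions : Prop :=
  forall (J : {set S}) (E : S -> set Omega),
    (forall x, x \in J -> <<s gen_state x >> (E x)) ->
    fine (P [set w | forall x, x \in J -> E x w]) =
      \prod_(x in J) fine (P (E x)).

Definition absorbing (x : S) : Prop := forall w b, p w x b x = 1.

Definition edge (x y : S) : Prop :=
  ~ absorbing x /\ exists w b, 0 < p w x b y.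

(* (A2): the MDP is a directed acyclic graph (no state can be revisited,
   apart from staying in a terminal absorbing state). *)
Definition acyclic_mdp : Prop := forall x : S, ~ clos_trans S edge x x.

Definition u_t gamma pi r s a : R :=
  var_next pi pbar s a (Qbar gamma pi r)
  - Ex (fun w => var_next pi (p w) s a (Qpi gamma pi (p w) r)).

Definition w_t gamma pi r s a : R :=
  Var (fun w => mean_next pi (p w) s a (Qbar gamma pi r)).

Definition g_t gamma pi r s a : R :=
  Ex (fun w => var_next pi (p w) s a (Qpi gamma pi (p w) r)
               - var_next pi (p w) s a (Qbar gamma pi r)).

End MDP.

(* Main.v *)
Require Import Defs.
From HB Require Import structures.
From mathcomp Require Import all_boot all_order all_algebra.
From mathcomp Require Import all_classical all_reals all_analysis measurable_realfun.
From mathcomp Require Import lra ring.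
From Stdlib Require Import Relations.
Import Order.TTheory GRing.Theory Num.Theory numFieldNormedType.Exports.
Local Open Scope classical_set_scope.
Local Open Scope ring_scope.

(** The identity [u = w - g] is only linearity of the expectation: expanding
    each variance as a second moment minus a squared mean, it comes down to
    [E (mean_p Qbar) = mean_pbar Qbar] and [E (mean_p Qbar^2) = mean_pbar Qbar^2].

    For [g >= 0], write [Q = Qbar + D] with [E D = 0].  Then
    [V_p Q - V_p Qbar = V_p D + 2 Cov_p (Qbar, D)], and the covariance has zero
    expectation because, for every successor [s'] of [s], [D (s', .)] is
    independent of [p (.|s, .)]: by acyclicity [Q (s', .)] is a function of the
    rows [p (.|x, .)] with [x <> s] only.  An absorbing [s] is its own successor,
    but there [Q (s, .)] is deterministic, so [D = 0]. *)

(** * Bounded measurable functions and their algebra *)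

Definition bounded_mfun {R : realType} {d} {T : measurableType d} (X : T -> R) :=
  measurable_fun setT X /\ exists M, forall w, `|X w| <= M.

Section BoundedMeasurable.
Context {R : realType} {d} {T : measurableType d}.
Implicit Types X Y : T -> R.

Lemma bounded_mfun_cst (c : R) : bounded_mfun (fun _ : T => c).
Proof. by split; [exact: measurable_cst|exists `|c|]. Qed.

Lemma bounded_mfunD X Y : bounded_mfun X -> bounded_mfun Y ->
  bounded_mfun (fun w => X w + Y w).
Proof.
move=> [mX [M hM]] [mY [N hN]]; split; first exact: measurable_funD.
by exists (M + N) => w; rewrite (le_trans (ler_normD _ _))// lerD.
Qed.

Lemma bounded_mfunM X Y : bounded_mfun X -> bounded_mfun Y ->
  bounded_mfun (fun w => X w * Y w).
Proof.
move=> [mX [M hM]] [mY [N hN]]; split; first exact: measurable_funM.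
by exists (M * N) => w; rewrite normrM ler_pM.
Qed.

Lemma bounded_mfunN X : bounded_mfun X -> bounded_mfun (fun w => - X w).
Proof.
move=> [mX [M hM]]; split; first exact: measurableT_comp.
by exists M => w; rewrite normrN.
Qed.

Lemma bounded_mfunB X Y : bounded_mfun X -> bounded_mfun Y ->
  bounded_mfun (fun w => X w - Y w).
Proof. by move=> bX bY; apply: bounded_mfunD => //; exact: bounded_mfunN. Qed.

Lemma bounded_mfunX X n : bounded_mfun X -> bounded_mfun (fun w => X w ^+ n).
Proof.
move=> bX; elim: n => [|n IH]; first exact: bounded_mfun_cst.
under eq_fun do rewrite exprS.
exact: bounded_mfunM.
Qed.

Lemma bounded_mfun_sum (I : Type) (s : seq I) (F : I -> T -> R) :
  (forall i, bounded_mfun (F i)) -> bounded_mfun (fun w => \sum_(i <- s) F i w).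
Proof.
move=> bF; elim: s => [|i s IH].
  by under eq_fun do rewrite big_nil; exact: bounded_mfun_cst.
under eq_fun do rewrite big_cons.
exact: bounded_mfunD.
Qed.

End BoundedMeasurable.

(** * Expectation on bounded variables, and the product rule under independence *)

Section Expectation.
Context {R : realType} {d} {T : measurableType d} (P : probability T R).
Implicit Types X Y : T -> R.

(** A bounded measurable function is integrable because [P] is finite. Boundedness, unlike
    integrability, is stable under products, so it is the condition carried throughout. *)
Lemma bounded_mfun_integrable X :
  bounded_mfun X -> P.-integrable setT (EFin \o X).
Proof.
move=> [mX [M hM]]; apply: measurable_bounded_integrable => //.
  by rewrite (le_lt_trans (probability_le1 _ _)) ?ltry.
exists M; split; first exact: num_real.
by move=> x Mx w _; exact: le_trans (hM w) (ltW Mx).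
Qed.

Lemma Ex_cst c : Ex P (fun _ => c) = c.
Proof.
rewrite [LHS]Rintegral_cst// -[RHS]mulr1; congr (_ * _).
exact: (congr1 fine (probability_setT P)).
Qed.

Lemma ExD X Y : bounded_mfun X -> bounded_mfun Y ->
  Ex P (fun w => X w + Y w) = Ex P X + Ex P Y.
Proof.
by move=> bX bY; rewrite [LHS]RintegralD//; exact: bounded_mfun_integrable.
Qed.

Lemma ExZl c X : bounded_mfun X -> Ex P (fun w => c * X w) = c * Ex P X.
Proof. by move=> bX; rewrite [LHS]RintegralZl//; exact: bounded_mfun_integrable. Qed.

Lemma ExZr c X : bounded_mfun X -> Ex P (fun w => X w * c) = Ex P X * c.
Proof. by move=> bX; rewrite [LHS]RintegralZr//; exact: bounded_mfun_integrable. Qed.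

Lemma ExB X Y : bounded_mfun X -> bounded_mfun Y ->
  Ex P (fun w => X w - Y w) = Ex P X - Ex P Y.
Proof.
by move=> bX bY; rewrite [LHS]RintegralB//; exact: bounded_mfun_integrable.
Qed.

Lemma Ex_sum (I : Type) (s : seq I) (F : I -> T -> R) :
  (forall i, bounded_mfun (F i)) ->
  Ex P (fun w => \sum_(i <- s) F i w) = \sum_(i <- s) Ex P (F i).
Proof.
move=> bF; elim: s => [|i s IH].
  by rewrite big_nil; under eq_fun do rewrite big_nil; exact: Ex_cst.
rewrite big_cons -IH; under eq_fun do rewrite big_cons.
by rewrite ExD//; exact: bounded_mfun_sum.
Qed.

Lemma Ex_ge0 X : (forall w, 0 <= X w) -> 0 <= Ex P X.
Proof. by move=> X0; exact: Rintegral_ge0. Qed.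

(** By independence the joint law of [(X, Y)] agrees with the product of the marginal laws on
    rectangles, hence everywhere; Tonelli then splits the integral. *)
Let ge0_Ex_mul_indep X Y : bounded_mfun X -> bounded_mfun Y ->
  (forall w, 0 <= X w) -> (forall w, 0 <= Y w) ->
  (forall A B : set R, measurable A -> measurable B ->
    P (X @^-1` A `&` Y @^-1` B) = (P (X @^-1` A) * P (Y @^-1` B))%E) ->
  Ex P (fun w => X w * Y w) = Ex P X * Ex P Y.
Proof.
move=> bX bY X0 Y0 indepXY.
have [mX _] := bX; have [mY _] := bY.
have mXY : measurable_fun setT (fun w => (X w, Y w)).
  exact: measurable_fun_pair.
pose X' : {mfun T >-> R} := mfun_Sub (mem_set mX).
pose Y' : {mfun T >-> R} := mfun_Sub (mem_set mY).
pose XY' : {mfun T >-> _} := mfun_Sub (mem_set mXY).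
pose PX := distribution P X'.
pose PY := distribution P Y'.
(* Absolute values make the product nonnegative on all of R * R, as Tonelli requires. *)
pose f (z : R * R) : \bar R := (`|z.1| * `|z.2|)%:E.
have mf : measurable_fun setT f.
  apply/measurable_EFinP; apply: measurable_funM.
    exact: measurableT_comp.
  exact: measurableT_comp.
have f0 z : (0 <= f z)%E by rewrite lee_fin.
have mn : measurable_fun [set: R] (fun x : R => `|x|%:E).
  by apply/measurable_EFinP; exact: (measurableT_comp (@normr_measurable _ _)).
have n0 (x : R) : (0 <= `|x|%:E)%E by rewrite lee_fin.
have finE Z : bounded_mfun Z -> (\int[P]_w (Z w)%:E)%E = (Ex P Z)%:E.
  move=> bZ; rewrite /Ex fineK//; apply: integrable_fin_num => //.
  exact: bounded_mfun_integrable.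
have EX : (\int[PX]_x `|x|%:E = (Ex P X)%:E)%E.
  rewrite ge0_integral_distribution// -finE//; apply: eq_integral => w _ /=.
  by rewrite ger0_norm.
have EY : (\int[PY]_x `|x|%:E = (Ex P Y)%:E)%E.
  rewrite ge0_integral_distribution// -finE//; apply: eq_integral => w _ /=.
  by rewrite ger0_norm.
apply: EFin_inj; rewrite -finE; last exact: bounded_mfunM.
transitivity (\int[distribution P XY']_z f z)%E.
  rewrite ge0_integral_distribution//; apply: eq_integral => w _ /=.
  by rewrite /f /= !ger0_norm.
transitivity (\int[PX \x PY]_z f z)%E.
  apply: eq_measure_integral => Z mZ _; symmetry.
  apply: (@product_measure_unique _ _ _ _ _ PX PY (distribution P XY')) => [A B mA mB|]; last exact: mZ.
  exact: indepXY.
transitivity (\int[PX]_x \int[PY]_y f (x, y))%E; first exact: fubini_tonelli1.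
rewrite /f /=.
under eq_integral => x _.
  under eq_integral do rewrite EFinM.
  rewrite ge0_integralZl_EFin// EY.
  over.
by rewrite ge0_integralZr// ?EX// lee_fin Ex_ge0.
Qed.

(* Bounded variables become nonnegative after adding constants. *)
Lemma Ex_mul_indep X Y : bounded_mfun X -> bounded_mfun Y ->
  (forall A B : set R, measurable A -> measurable B ->
    P (X @^-1` A `&` Y @^-1` B) = (P (X @^-1` A) * P (Y @^-1` B))%E) ->
  Ex P (fun w => X w * Y w) = Ex P X * Ex P Y.
Proof.
move=> bX bY indepXY; have [_ [M hM]] := bX; have [_ [N hN]] := bY.
have bc c := @bounded_mfun_cst R d T c.
have bXM := bounded_mfunD _ _ bX (bc M).
have bYN := bounded_mfunD _ _ bY (bc N).
have shift_meas c (A : set R) : measurable A -> measurable [set x | A (x + c)].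
  move=> mA; rewrite -[X in measurable X]setTI.
  by apply: (measurable_funD (@measurable_id _ _ _) (measurable_cst c)).
have pos (z K : R) : `|z| <= K -> 0 <= z + K.
  by rewrite ler_norml => /andP[+ _]; rewrite -subr_ge0 opprK.
have bXY := bounded_mfunM _ _ bX bY.
have bNX := bounded_mfunM _ _ (bc N) bX.
have bMY := bounded_mfunM _ _ (bc M) bY.
have bS := bounded_mfunD _ _ bNX bMY.
have bXYS := bounded_mfunD _ _ bXY bS.
have : Ex P (fun w => (X w + M) * (Y w + N)) =
    Ex P (fun w => X w + M) * Ex P (fun w => Y w + N).
  apply: ge0_Ex_mul_indep => // [w|w|A B mA mB]; [exact: pos|exact: pos|].
  exact: (indepXY _ _ (shift_meas M _ mA) (shift_meas N _ mB)).
have -> : (fun w => (X w + M) * (Y w + N)) =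
    (fun w => (X w * Y w + (N * X w + M * Y w)) + M * N).
  by apply/funext => w; ring.
rewrite (ExD _ _ bXYS (bc _)) (ExD _ _ bXY bS) (ExD _ _ bNX bMY).
rewrite (ExD _ _ bX (bc _)) (ExD _ _ bY (bc _)) !Ex_cst !ExZl//.
lra.
Qed.

End Expectation.

(** * The rows of one state are independent of the rows of all the others *)

Section Independence.
Context {R : realType} {S A : finType} {d} {Omega : measurableType d}.
Variables (P : probability Omega R) (p : Omega -> S -> A -> S -> R).
Hypothesis mp : forall x b y, measurable_fun setT (fun w => p w x b y).
Hypothesis indep : indep_transitions P p.

(* A pi-system generating the sigma-algebra of the rows [p (.|x, .)], [x <> s]. *)
Definition off_state (s : S) : set (set Omega) :=
  [set B | exists E : S -> set Omega, (forall x, <<s gen_state p x >> (E x)) /\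
    B = [set w | forall x, x != s -> E x w]].

Lemma gen_state_measurable x E : <<s gen_state p x >> E -> measurable E.
Proof.
move: E; apply: smallest_sub; first exact: sigma_algebra_measurable.
move=> _ [b [y [B [mB ->]]]].
by rewrite -[X in measurable X]setTI; exact: mp.
Qed.

Lemma off_state_measurable s B : off_state s B -> measurable B.
Proof.
move=> [E [gE ->]].
have -> : [set w | forall x, x != s -> E x w] = \bigcap_(x in [set x | x != s]) E x.
  by apply/seteqP; split => w h x; exact: h.
apply: fin_bigcap_measurable; first exact: finite_finset.
by move=> x _; exact: gen_state_measurable (gE x).
Qed.

Lemma setI_closed_off_state s : setI_closed (off_state s).
Proof.
move=> _ _ [E [gE ->]] [F [gF ->]]; exists (fun x => E x `&` F x); split.
  by move=> x; exact: (@measurableI _ (g_sigma_algebraType (gen_state p x)) _ _ (gE x) (gF x)).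
apply/seteqP; split => [w [h1 h2] x xs|w h]; first by split; [exact: h1|exact: h2].
by split => x xs; have [] := h _ xs.
Qed.

Lemma off_state_gen_state s x E : x != s -> gen_state p x E -> off_state s E.
Proof.
(* [E] constrains the state [x] only, so the other components are trivial. *)
move=> xs gE; exists (fun y => if y == x then E else setT); split.
  move=> y; case: eqP => [->|_]; first exact: sub_sigma_algebra.
  exact: (@measurableT _ (g_sigma_algebraType (gen_state p y))).
apply/seteqP; split => [w Ew y _|w /(_ _ xs)]; last by rewrite eqxx.
by case: eqP.
Qed.

(** Mutual independence is applied twice, to all states and to all states but [s]: the product over
    [x != s] in the first identity is [P B] by the second. *)
Let gen_state_off_state_indep s E B : <<s gen_state p s >> E -> off_state s B ->
  P (E `&` B) = (P E * P B)%E.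
Proof.
move=> gE oB; have mE := gen_state_measurable _ _ gE.
have mB := off_state_measurable _ _ oB.
have [F [gF BE]] := oB.
(* [B] ignores the component of [F] at [s], which can thus be overwritten by [E]. *)
pose F' x := if x == s then E else F x.
have gF' x : <<s gen_state p x >> (F' x).
  by rewrite /F'; case: eqP => [->|_].
have := indep [set: S]%SET F' (fun x _ => gF' x).
rewrite (bigD1 s) ?inE//=; have -> : F' s = E by rewrite /F' eqxx.
have -> : [set w | forall x : S, x \in [set: S]%SET -> F' x w] = E `&` B.
  rewrite BE; apply/seteqP; split => [w h|w [Ew h] x _].
    split; first by have := h s; rewrite inE /F' eqxx => /(_ isT).
    by move=> x xs; have := h x; rewrite inE /F' (negPf xs) => /(_ isT).
  by rewrite /F'; case: eqP => [//|/eqP /h].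
have -> : \prod_(i in [set: S]%SET | i != s) fine (P (F' i)) = fine (P B).
  have := indep [set~ s]%SET F' (fun x _ => gF' x).
  have -> : [set w | forall x : S, x \in [set~ s]%SET -> F' x w] = B.
    rewrite BE; apply/seteqP; split => w h x xs.
      by have := h x; rewrite !inE /F' xs (negPf xs) => /(_ isT).
    by move: xs; rewrite !inE /F' => xs; rewrite (negPf xs); exact: h.
  by move=> ->; apply: eq_bigl => x; rewrite !inE.
move=> H; rewrite -(fineK (fin_num_measure P _ (measurableI _ _ mE mB))) H.
by rewrite EFinM !fineK// fin_num_measure.
Qed.

(** Dynkin's pi-lambda argument: for fixed [E], the measurable sets independent of [E] form a
    lambda-system containing the pi-system [off_state s]. *)
Lemma gen_state_indep s E B : <<s gen_state p s >> E -> <<s off_state s >> B ->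
  measurable B /\ P (E `&` B) = (P E * P B)%E.
Proof.
move=> gE; have mE := gen_state_measurable _ _ gE.
move: B; apply: (@lambda_system_subset _ _ (setI_closed_off_state s) setT
  [set B | measurable B /\ P (E `&` B) = (P E * P B)%E]) => //; last first.
  move=> B oB; split; first exact: off_state_measurable oB.
  exact: gen_state_off_state_indep gE oB.
apply/dynkin_lambda_system; split => [|B [mB indepB]|F tF HF].
- by split => //; rewrite setIT probability_setT mule1.
- split; first exact: measurableC.
  have Efin : (P E < +oo)%E by rewrite (le_lt_trans (probability_le1 _ _)) ?ltry.
  have -> : P (E `&` ~` B) = (P E - P (E `&` B))%E.
    by rewrite -setDE; exact: measureD.
  have -> : P (~` B) = (1 - P B)%E by exact: probability_setC.
  by rewrite indepB muleBr ?mule1// ?fin_num_adde_defr ?fin_num_measure.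
- have mF n : measurable (F n) by have [] := HF n.
  split; first exact: bigcupT_measurable.
  rewrite setI_bigcupr !measure_bigcup//; last 2 first.
  + by move=> n _; exact: measurableI.
  + exact: trivIset_setIl.
  have -> : P E = (fine (P E))%:E by rewrite fineK// fin_num_measure.
  rewrite -nneseriesZl//; apply: eq_eseriesr => n _.
  by rewrite fineK ?fin_num_measure//; have [] := HF n.
Qed.

(** The two measurability hypotheses express that [X] depends on the rows of [s] only and [Y] on the
    other rows only. *)
Lemma Ex_mul_off_state s (X Y : Omega -> R) :
  (exists M, forall w, `|X w| <= M) -> (exists M, forall w, `|Y w| <= M) ->
  measurable_fun setT (X : g_sigma_algebraType (gen_state p s) -> R) ->
  measurable_fun setT (Y : g_sigma_algebraType (off_state s) -> R) ->
  Ex P (fun w => X w * Y w) = Ex P X * Ex P Y.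
Proof.
move=> bX bY mX mY.
have gX B : measurable B -> <<s gen_state p s >> (X @^-1` B).
  by move=> mB; rewrite -[X in _ X]setTI; exact: mX.
have gY B : measurable B -> <<s off_state s >> (Y @^-1` B).
  by move=> mB; rewrite -[X in _ X]setTI; exact: mY.
apply: Ex_mul_indep.
- split => // _ B mB; rewrite setTI.
  by apply: (gen_state_measurable s); exact: gX.
- split => // _ B mB; rewrite setTI.
  (* Only the measurability half is wanted here, so [setT] serves as the event on the side of
     [s]. *)
  by have [] := gen_state_indep s setT _ (@measurableT _ (g_sigma_algebraType (gen_state p s))) (gY _ mB).
- move=> B C mB mC.
  by have [] := gen_state_indep s _ _ (gX _ mB) (gY _ mC).
Qed.

End Independence.

(** * Finite distributions *)

Section Distributions.
Context {R : realType} {T : finType}.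
Implicit Types f g : T -> R.

Lemma distr_le1 f t : is_distr_on f -> f t <= 1.
Proof.
move=> [f0 <-]; rewrite (bigD1 t)//= lerDl.
by apply: sumr_ge0.
Qed.

Lemma distr_mean_le f g M : is_distr_on f -> (forall t, `|g t| <= M) ->
  `|\sum_t f t * g t| <= M.
Proof.
move=> [f0 f1] gM; rewrite (le_trans (ler_norm_sum _ _ _))//.
rewrite -[leRHS]mul1r -f1 mulr_suml; apply: ler_sum => t _.
by rewrite normrM (ger0_norm (f0 t)) ler_wpM2l.
Qed.

(** No mass is left for the other points. Since [absorbing] only prescribes the self-loop
    probability, this is what determines the whole row. *)
Lemma distr_point_mass f t : is_distr_on f -> f t = 1 ->
  forall y, f y = (y == t)%:R.
Proof.
move=> [f0 f1] ft y; have [->|yt]//= := eqVneq y t.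
apply/eqP; rewrite eq_le f0 andbT -(lerD2l (f t)) addr0 ft -{1}ft -f1.
rewrite (bigD1 t)//= (bigD1 y)//= addrA lerDl.
by apply: sumr_ge0.
Qed.

End Distributions.

(** * Convergence, boundedness and measurability of the action value *)

Section ActionValue.
Context {R : realType} {S A : finType}.
Variables (r : S -> A -> R) (gamma : R) (pi : S -> A -> R).
Hypotheses (gamma0 : 0 <= gamma) (gamma1 : gamma < 1) (hpi : is_policy pi).

(** The total of all [|r x b|] is a crude uniform bound on the reward, and averaging against
    distributions preserves it. *)
Lemma ER_bound q h s a : is_transition q ->
  `|ER pi q r h s a| <= \sum_x \sum_b `|r x b|.
Proof.
move=> hq; elim: h s a => [|h IH] s a /=.
  rewrite (bigD1 s)//= (bigD1 a)//= -addrA lerDl addr_ge0 ?sumr_ge0// => x _.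
  exact: sumr_ge0.
by apply: distr_mean_le => // y; apply: distr_mean_le.
Qed.

(** Comparison with a geometric series of ratio [gamma]. Convergence is recorded as well, since
    [Qpi] is a [limn], meaningful only when the series converges. *)
Lemma Qpi_cvg_bound q s a : is_transition q ->
  cvgn (series (fun h => gamma ^+ h * ER pi q r h s a)) /\
  `|Qpi gamma pi q r s a| <= (\sum_x \sum_b `|r x b|) / (1 - gamma).
Proof.
move=> hq; set M := \sum_x _; set u := fun h => _.
have ng : `|gamma| < 1 by rewrite ger0_norm.
have uM n : `|u n| <= geometric M gamma n.
  rewrite /u /geometric /= normrM ger0_norm ?exprn_ge0// mulrC.
  by rewrite ler_wpM2r ?exprn_ge0//; exact: ER_bound.
have cg := is_cvg_geometric_series (a := M) ng.
have cn : cvgn [normed series u].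
  apply: (series_le_cvg (v_ := geometric M gamma)) => [n|n|n|].
  - exact: normr_ge0.
  - exact: le_trans (normr_ge0 _) (uM n).
  - exact: uM.
  - exact: cg.
split; first exact: normed_cvg.
apply: le_trans (lim_series_norm cn) _.
rewrite -(cvg_lim _ (cvg_geometric_series (a := M) ng))//.
exact: lim_series_le.
Qed.

(* [C] is a set of states closed under possible transitions; only the rows in
   [C] need to be measurable, so the sigma-algebra on [T] may ignore the others. *)
Lemma ER_measurable {d} {T : measurableType d} (q : T -> S -> A -> S -> R)
    (C : S -> Prop) :
  (forall x b y, C x -> measurable_fun setT (fun w => q w x b y)) ->
  (forall x b y, C x -> (forall w, q w x b y = 0) \/ C y) ->
  forall h x b, C x -> measurable_fun setT (fun w => ER pi (q w) r h x b).
Proof.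
move=> mq Cq; elim=> [|h IH] x b Cx /=; first exact: measurable_cst.
apply: measurable_sum => y; have [q0|Cy] := Cq x b y Cx.
  by under eq_fun do rewrite q0 mul0r; exact: measurable_cst.
apply: measurable_funM; first exact: mq.
apply: measurable_sum => c; apply: measurable_funM => //; exact: IH.
Qed.

(** A pointwise limit of measurable partial sums. The sigma-algebra on [T] stays abstract, to serve
    both for the ambient one and for the one generated by [off_state]. *)
Lemma Qpi_measurable {d} {T : measurableType d} (q : T -> S -> A -> S -> R) s a :
  (forall w, is_transition (q w)) ->
  (forall h, measurable_fun setT (fun w => ER pi (q w) r h s a)) ->
  measurable_fun setT (fun w => Qpi gamma pi (q w) r s a).
Proof.
move=> hq mER.
apply: (measurable_fun_cvg
  (h := fun n w => series (fun h => gamma ^+ h * ER pi (q w) r h s a) n)).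
  move=> n; apply: measurable_sum => h; exact: measurable_funM.
by move=> w _; have [] := Qpi_cvg_bound (q w) s a (hq w).
Qed.

End ActionValue.

(** * Mean and variance over one transition *)

Section MeanVariance.
Context {R : realType} {S A : finType}.
Variables (pi : S -> A -> R) (q : S -> A -> S -> R) (s : S) (a : A).
Hypotheses (hpi : is_policy pi) (hq : is_transition q).
Implicit Types f g : S -> A -> R.
Local Notation mean := (mean_next pi q s a).
Local Notation var := (var_next pi q s a).

Lemma mean_nextD f g : mean (fun x b => f x b + g x b) = mean f + mean g.
Proof.
rewrite /mean_next -big_split; apply: eq_bigr => x _.
by rewrite -big_split; apply: eq_bigr => b _; rewrite mulrDr.
Qed.

Lemma mean_nextZ c f : mean (fun x b => c * f x b) = c * mean f.
Proof.
rewrite /mean_next mulr_sumr; apply: eq_bigr => x _.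
by rewrite mulr_sumr; apply: eq_bigr => b _; rewrite mulrCA.
Qed.

Lemma mean_next_cst c : mean (fun _ _ => c) = c.
Proof.
have -> : mean (fun _ _ => c) = (\sum_x q s a x * \sum_b pi x b) * c.
  rewrite /mean_next mulr_suml; apply: eq_bigr => x _.
  by rewrite mulr_sumr mulr_suml; apply: eq_bigr => b _; rewrite (mulrC (pi x b)).
have [_ q1] := hq s a.
rewrite -[RHS]mul1r -q1; congr (_ * _); apply: eq_bigr => x _.
by have [_ ->] := hpi x; rewrite mulr1.
Qed.

Lemma var_nextE f : var f = mean (fun x b => f x b ^+ 2) - mean f ^+ 2.
Proof.
have -> : var f = mean (fun x b => (f x b - mean f) ^+ 2) by [].
set m := mean f.
have -> : (fun x b => (f x b - m) ^+ 2) =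
    (fun x b => f x b ^+ 2 + ((- 2 * m) * f x b + m ^+ 2)).
  by apply/funext => x; apply/funext => b; ring.
by rewrite !mean_nextD mean_nextZ mean_next_cst -/m; ring.
Qed.

Lemma var_next_ge0 f : 0 <= var f.
Proof.
apply: sumr_ge0 => x _; apply: sumr_ge0 => b _.
have [p0 _] := hpi x; have [q0 _] := hq s a.
by apply: mulr_ge0; [exact: mulr_ge0|exact: sqr_ge0].
Qed.

(** This is the variance of the sum [g + D]; the bracket is the covariance of [g] and [D]. *)
Lemma var_nextB f g (D := fun x b => f x b - g x b) :
  var f - var g =
  var D + 2 * (mean (fun x b => g x b * D x b) - mean g * mean D).
Proof.
have fE : f = fun x b => g x b + D x b.
  by apply/funext => x; apply/funext => b; rewrite /D addrC subrK.
rewrite !var_nextE.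
have -> : (fun x b => f x b ^+ 2) =
    (fun x b => g x b ^+ 2 + (2 * (g x b * D x b) + D x b ^+ 2)).
  by apply/funext => x; apply/funext => b; rewrite /D; ring.
rewrite {1}fE !mean_nextD mean_nextZ; ring.
Qed.

End MeanVariance.

(** * Random transitions and the decomposition of [u_t] *)

Section RandomMDP.
Context {R : realType} {S A : finType} {d} {Omega : measurableType d}.
Variables (P : probability Omega R) (p : Omega -> S -> A -> S -> R).
Variables (r : S -> A -> R) (gamma : R) (pi : S -> A -> R).
Hypotheses (gamma0 : 0 <= gamma) (gamma1 : gamma < 1) (hpi : is_policy pi).
Hypothesis hp : forall w, is_transition (p w).
Hypothesis mp : forall x b y, measurable_fun setT (fun w => p w x b y).
Local Notation Q w := (Qpi gamma pi (p w) r).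
Local Notation Qb := (Qbar P p gamma pi r).
Local Notation D w x b := (Qpi gamma pi (p w) r x b - Qbar P p gamma pi r x b).

Lemma transition_bounded_mfun x b y : bounded_mfun (fun w => p w x b y).
Proof.
split => //; exists 1 => w; have [p0 _] := hp w x b.
by rewrite ger0_norm ?p0 // (distr_le1 _ _ (hp w x b)).
Qed.

Lemma Qpi_bounded_mfun x b : bounded_mfun (fun w => Q w x b).
Proof.
split.
  apply: Qpi_measurable => // h.
  by apply: (@ER_measurable _ _ _ _ _ _ _ p (fun=> True)) => //; right.
exists ((\sum_x \sum_b `|r x b|) / (1 - gamma)) => w.
by have [] := Qpi_cvg_bound r gamma pi gamma0 gamma1 hpi (p w) x b (hp w).
Qed.

Lemma Qpi_dev_bounded_mfun x b : bounded_mfun (fun w => D w x b).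
Proof.
by apply: bounded_mfunB; [exact: Qpi_bounded_mfun|exact: bounded_mfun_cst].
Qed.

Lemma Ex_Qpi_dev x b : Ex P (fun w => D w x b) = 0.
Proof.
rewrite ExB ?Ex_cst ?subrr//; [exact: Qpi_bounded_mfun|exact: bounded_mfun_cst].
Qed.

Lemma mean_next_bounded_mfun s a (F : Omega -> S -> A -> R) :
  (forall x b, bounded_mfun (fun w => F w x b)) ->
  bounded_mfun (fun w => mean_next pi (p w) s a (F w)).
Proof.
move=> bF; apply: bounded_mfun_sum => x; apply: bounded_mfun_sum => b.
apply: bounded_mfunM => //; apply: bounded_mfunM.
  exact: bounded_mfun_cst.
exact: transition_bounded_mfun.
Qed.

(** The factor [X] lets one formula treat both halves of the covariance: [X] is 1 for the mean of a
    product, and a one-step mean for the product of means. *)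
Lemma Ex_mul_mean_next s a X (F : Omega -> S -> A -> R) : bounded_mfun X ->
  (forall x b, bounded_mfun (fun w => F w x b)) ->
  Ex P (fun w => X w * mean_next pi (p w) s a (F w)) =
  \sum_x \sum_b pi x b * Ex P (fun w => X w * (p w s a x * F w x b)).
Proof.
move=> bX bF.
have bXF x b : bounded_mfun (fun w => X w * (p w s a x * F w x b)).
  apply: bounded_mfunM => //; apply: bounded_mfunM => //.
  exact: transition_bounded_mfun.
have bpXF x b : bounded_mfun (fun w => pi x b * (X w * (p w s a x * F w x b))).
  by apply: bounded_mfunM => //; exact: bounded_mfun_cst.
have -> : (fun w => X w * mean_next pi (p w) s a (F w)) =
    (fun w => \sum_x \sum_b pi x b * (X w * (p w s a x * F w x b))).
  apply/funext => w; rewrite mulr_sumr; apply: eq_bigr => x _.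
  by rewrite mulr_sumr; apply: eq_bigr => b _; ring.
rewrite Ex_sum => [|x]; last exact: bounded_mfun_sum.
apply: eq_bigr => x _; rewrite Ex_sum//.
by apply: eq_bigr => b _; rewrite ExZl.
Qed.

(** For deterministic [f] the one-step mean is linear in the transition probabilities. *)
Lemma Ex_mean_next_cst s a f :
  Ex P (fun w => mean_next pi (p w) s a f) = mean_next pi (pbar P p) s a f.
Proof.
have := @Ex_mul_mean_next s a (fun=> 1) (fun=> f) (bounded_mfun_cst 1)
  (fun x b => bounded_mfun_cst (f x b)).
under eq_fun do rewrite mul1r.
move=> ->; apply: eq_bigr => x _; apply: eq_bigr => b _.
under eq_fun do rewrite mul1r.
by rewrite ExZr ?mulrA//; exact: transition_bounded_mfun.
Qed.

Lemma pbar_transition : is_transition (pbar P p).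
Proof.
move=> x b; split=> [y|].
  by apply: Ex_ge0 => w; have [] := hp w x b.
rewrite -Ex_sum; last by move=> y; exact: transition_bounded_mfun.
rewrite -[RHS](Ex_cst P); congr (Ex P _); apply/funext => w.
by have [] := hp w x b.
Qed.

Lemma uwg_decomposition s a :
  u_t P p gamma pi r s a = w_t P p gamma pi r s a - g_t P p gamma pi r s a.
Proof.
have bQ := Qpi_bounded_mfun.
have bQb x b : bounded_mfun (fun _ : Omega => Qb x b) := bounded_mfun_cst _.
have bvar F : (forall x b, bounded_mfun (fun w => F w x b)) ->
    bounded_mfun (fun w => var_next pi (p w) s a (F w)).
  move=> bF; under eq_fun do rewrite var_nextE//.
  apply: bounded_mfunB; last by apply: bounded_mfunX; exact: mean_next_bounded_mfun.
  by apply: mean_next_bounded_mfun => x b; exact: bounded_mfunX.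
have bmean := mean_next_bounded_mfun s a (fun=> Qb) bQb.
(* The second moment is linear in [p w] and averages to its value at [pbar]; the squared mean is not
   linear and stays under the expectation. *)
have Evar : Ex P (fun w => var_next pi (p w) s a Qb) =
    mean_next pi (pbar P p) s a (fun x b => Qb x b ^+ 2) -
    Ex P (fun w => mean_next pi (p w) s a Qb ^+ 2).
  rewrite -Ex_mean_next_cst -ExB; last exact: bounded_mfunX.
    by congr (Ex P _); apply/funext => w; rewrite var_nextE.
  by apply: mean_next_bounded_mfun => x b; exact: bounded_mfunX.
have EVar : w_t P p gamma pi r s a =
    Ex P (fun w => mean_next pi (p w) s a Qb ^+ 2) -
    mean_next pi (pbar P p) s a Qb ^+ 2.
  rewrite /w_t /Var Ex_mean_next_cst; set m := mean_next pi (pbar P p) s a Qb.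
  have -> : (fun w => (mean_next pi (p w) s a Qb - m) ^+ 2) =
      (fun w => mean_next pi (p w) s a Qb ^+ 2 +
        ((- 2 * m) * mean_next pi (p w) s a Qb + m ^+ 2)).
    by apply/funext => w; ring.
  have b1 : bounded_mfun (fun w => (- 2 * m) * mean_next pi (p w) s a Qb).
    by apply: bounded_mfunM => //; exact: bounded_mfun_cst.
  have b2 : bounded_mfun (fun _ : Omega => m ^+ 2) by exact: bounded_mfun_cst.
  rewrite ExD; [|exact: bounded_mfunX|exact: bounded_mfunD].
  by rewrite ExD// ExZl// Ex_cst Ex_mean_next_cst -/m; ring.
(* The expected variance of the random value occurs on both sides, and the expected squared mean
   cancels between [w_t] and [g_t]. *)
rewrite EVar /u_t /g_t ExB; [|exact: bvar|exact: bvar].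
rewrite Evar (var_nextE _ _ _ _ hpi pbar_transition); ring.
Qed.

(** * Nonnegativity of [g_t] from independence and acyclicity *)

Section Acyclic.
Hypothesis indep : indep_transitions P p.
Hypothesis acyc : acyclic_mdp p.

(** From such an [x] the rows of [s] are never consulted; [avoids s] plays the part of the closed
    set [C] of [ER_measurable]. *)
Definition avoids (s x : S) := x <> s /\ ~ clos_trans S (edge p) x s.

(** [edge] leaves out the self-loops of absorbing states, so these need a case of their own; there
    the row is a point mass. *)
Lemma transition_cases x b y : (forall w, p w x b y = 0) \/
  (absorbing p x /\ y = x) \/ edge p x y.
Proof.
have [p0|/existsNP[w pw]] := pselect (forall w, p w x b y = 0); first by left.
right; have [ax|nax] := pselect (absorbing p x).
  left; split => //; apply/eqP; apply/negP => /negP yx.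
  by apply: pw; rewrite (distr_point_mass _ _ (hp w x b) (ax w b)) (negPf yx).
right; split => //; exists w, b; have [p0 _] := hp w x b.
by rewrite lt_neqAle p0 andbT eq_sym; apply/eqP.
Qed.

Lemma avoids_next s x b y :
  avoids s x -> (forall w, p w x b y = 0) \/ avoids s y.
Proof.
move=> [xs nxs]; have [p0|[[_ ->]|exy]] := transition_cases x b y; first by left.
  by right.
right; split=> [ys|ys]; apply: nxs.
  by rewrite -ys; exact: t_step.
by apply: t_trans ys; exact: t_step.
Qed.

(** The state never moves, whichever transition function is drawn, so every expected reward is the
    same. *)
Lemma absorbing_Qpi s w w' b : absorbing p s -> Q w s b = Q w' s b.
Proof.
move=> ab; rewrite /Qpi.
suff ERE h c : ER pi (p w) r h s c = ER pi (p w') r h s c.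
  by under eq_fun do under eq_bigr do rewrite ERE.
elim: h c => [//|h IH] c /=; apply: eq_bigr => y _.
rewrite !(distr_point_mass _ _ (hp _ s c) (ab _ c)).
have [->|] := eqVneq y s; last by rewrite !mul0r.
by congr (_ * _); apply: eq_bigr => e _; rewrite IH.
Qed.

Lemma absorbing_Qpi_dev s w b : absorbing p s -> D w s b = 0.
Proof.
move=> ab; rewrite /Qbar.
have -> : (fun w => Q w s b) = (fun=> Q w s b).
  by apply/funext => w'; exact: absorbing_Qpi.
by rewrite Ex_cst subrr.
Qed.

Lemma transition_gen_state_measurable s a x :
  measurable_fun setT ((fun w => p w s a x) : g_sigma_algebraType (gen_state p s) -> R).
Proof.
move=> _ B mB; rewrite setTI; apply: sub_sigma_algebra.
by exists a, x, B.
Qed.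

(** Trajectories from [x] never meet [s], so only rows of other states enter the value. *)
Lemma avoids_Qpi_measurable s x b : avoids s x ->
  measurable_fun setT ((fun w => Q w x b) : g_sigma_algebraType (off_state p s) -> R).
Proof.
move=> sx; apply: Qpi_measurable => // h.
apply: (@ER_measurable _ _ _ _ _ _ (g_sigma_algebraType (off_state p s)) p (avoids s)) => //.
- move=> y c z [/eqP ys _] _ B mB; rewrite setTI; apply: sub_sigma_algebra.
  by apply: off_state_gen_state ys _; exists c, z, B.
- exact: avoids_next.
Qed.

(** Either the transition is impossible, or it is an absorbing self-loop and the deviation is zero,
    or it is an edge: then the centred deviation is independent of the rows of [s], hence of [X]
    times the transition probability. *)
Lemma Ex_transition_Qpi_dev s a X x b :
  (exists M, forall w, `|X w| <= M) ->
  measurable_fun setT (X : g_sigma_algebraType (gen_state p s) -> R) ->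
  Ex P (fun w => X w * (p w s a x * D w x b)) = 0.
Proof.
move=> [M bX] mX; have [p0|[[ab ->]|sx]] := transition_cases s a x.
- by under eq_fun do rewrite p0 mul0r mulr0; exact: Ex_cst.
- by under eq_fun do rewrite absorbing_Qpi_dev// !mulr0; exact: Ex_cst.
(* A path from [x] back to [s] would close a cycle with the edge from [s] to [x]. *)
have av : avoids s x.
  split=> [xs|xs]; first by apply: (acyc s); rewrite -{2}xs; exact: t_step.
  by apply: (acyc s); apply: t_trans xs; exact: t_step.
under eq_fun do rewrite mulrA.
have [_ bp] := transition_bounded_mfun s a x.
have [_ bD] := Qpi_dev_bounded_mfun x b.
rewrite (@Ex_mul_off_state _ _ _ _ _ _ _ mp indep s) ?Ex_Qpi_dev ?mulr0//.
- have [N bN] := bp; exists (M * N) => w.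
  by rewrite normrM ler_pM.
- by apply: measurable_funM => //; exact: transition_gen_state_measurable.
- apply: measurable_funB; last exact: measurable_cst.
  exact: avoids_Qpi_measurable.
Qed.

Lemma g_ge0 s a : 0 <= g_t P p gamma pi r s a.
Proof.
rewrite /g_t; under eq_fun do rewrite var_nextB//.
have bD := Qpi_dev_bounded_mfun.
have bQb x b : bounded_mfun (fun _ : Omega => Qb x b) := bounded_mfun_cst _.
have bmD := mean_next_bounded_mfun s a (fun w x b => D w x b) bD.
have bQD x b : bounded_mfun (fun w => Qb x b * D w x b).
  exact: bounded_mfunM.
have bmQD := mean_next_bounded_mfun s a _ bQD.
have bmQb := mean_next_bounded_mfun s a (fun=> Qb) bQb.
have bvar : bounded_mfun (fun w => var_next pi (p w) s a (fun x b => D w x b)).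
  under eq_fun do rewrite var_nextE//.
  apply: bounded_mfunB; last exact: bounded_mfunX.
  by apply: mean_next_bounded_mfun => x b; exact: bounded_mfunX.
have bmm := bounded_mfunM _ _ bmQb bmD.
have bcov := bounded_mfunB _ _ bmQD bmm.
rewrite ExD//; last by apply: bounded_mfunM => //; exact: bounded_mfun_cst.
rewrite ExZl// ExB// Ex_mul_mean_next// [X in X - _](_ : _ = 0) ?[X in _ - X](_ : _ = 0).
- rewrite subrr mulr0 addr0; apply: Ex_ge0 => w; exact: var_next_ge0.
(* Product of the means: [X] is the one-step mean of [Qbar], a function of the rows of [s]. *)
- apply: big1 => x _; apply: big1 => b _.
  rewrite Ex_transition_Qpi_dev ?mulr0//; first by case: bmQb.
  apply: measurable_sum => y; apply: measurable_sum => c.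
  apply: measurable_funM => //; apply: measurable_funM => //.
  exact: transition_gen_state_measurable.
(* Mean of the product: the constant [Qb x b] moves out of the product and takes the place of
   [X]. *)
- have := @Ex_mul_mean_next s a (fun=> 1) _ (bounded_mfun_cst 1) bQD.
  under eq_fun do rewrite mul1r.
  move=> ->; apply: big1 => x _; apply: big1 => b _.
  have -> : (fun w => 1 * (p w s a x * (Qb x b * D w x b))) =
      (fun w => Qb x b * (p w s a x * D w x b)).
    by apply/funext => w; ring.
  rewrite (Ex_transition_Qpi_dev s a (fun=> Qb x b)) ?mulr0//.
  by exists `|Qb x b|.
Qed.

End Acyclic.
End RandomMDP.

Theorem theorem5 (R : realType) (S A : finType)
    (r : S -> A -> R) (gamma : R)
    (d : measure_display) (Omega : measurableType d) (P : probability Omega R)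
    (p : Omega -> S -> A -> S -> R) :
  0 <= gamma -> gamma < 1 ->
  (forall w, is_transition (p w)) ->
  (forall x b y, measurable_fun setT (fun w => p w x b y)) ->
  indep_transitions P p ->   (* (A1) *)
  acyclic_mdp p ->           (* (A2) *)
  forall (s : S) (a : A) (pi : S -> A -> R), is_policy pi ->
    u_t P p gamma pi r s a = w_t P p gamma pi r s a - g_t P p gamma pi r s a
    /\ 0 <= g_t P p gamma pi r s a
    /\ u_t P p gamma pi r s a <= w_t P p gamma pi r s a.
Proof.
move=> gamma0 gamma1 hp mp indep acyc s a pi hpi.
have uwg : u_t P p gamma pi r s a = w_t P p gamma pi r s a - g_t P p gamma pi r s a.
  exact: uwg_decomposition.
have g0 : 0 <= g_t P p gamma pi r s a by exact: g_ge0.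
by rewrite uwg; split => //; split => //; rewrite gerBl.
Qed.
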